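(* Let $s\ge 1$, let $n=2s$, and let $N$ be a positive integer coprime to $n+1$. For $t>0$ let $S_t$ be the scaling of the projective invariants $a=(a_k^i)_{k\in\mathbb Z,\,1\le i\le n}$ of twisted $N$-gons in $\mathbb{RP}^n$ given by $$a_k^{2\ell+1}\mapsto t^{-1+\ell/s}\,a_k^{2\ell+1}\ (\ell=0,\dots,s-1),\qquad a_k^{2\ell}\mapsto t^{\ell/s}\,a_k^{2\ell}\ (\ell=1,\dots,s),\qquad k\in\mathbb Z .$$ Then the generalized pentagram map $T$ on $\mathbb{RP}^{2s}$, written as a map $a\mapsto T(a)$ on the projective invariants, is invariant under this scaling, i.e. $T(S_ta)=S_t\,T(a)$ for every $t>0$, whenever both sides are defined.
   Context: Twisted polygons: a twisted $N$-gon in $\mathbb{RP}^n$ is a sequence $x=(x_k)_{k\in\mathbb Z}$ of points of $\mathbb{RP}^n$ such that $x_{k+N}=M\cdot x_k$ for all $k$, for a fixed projective transformation $M\in \mathrm{PSL}(n+1,\mathbb R)$ (the monodromy); for $n$ even, $\mathrm{PSL}(n+1,\mathbb R)=\mathrm{SL}(n+1,\mathbb R)$. Lifts and invariants: polygons are assumed nondegenerate, meaning that there are lifts $V_k\in\mathbb R^{n+1}$ of $x_k$ with $V_{k+N}=MV_k$ and $\det(V_k,V_{k+1},\dots,V_{k+n})=1$ for all $k$. Since $N$ and $n+1$ are coprime and $n$ is even these lifts are unique. The projective invariants $a_k^i$ ($1\le i\le n$, $N$-periodic in $k$) are defined by $$V_{k+n+1}=a_k^nV_{k+n}+a_k^{n-1}V_{k+n-1}+\dots+a_k^1V_{k+1}+V_k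 .$$ Conversely any $N$-periodic family $a=(a_k^i)$ of real numbers determines via this recursion a sequence $(V_k)$ with $\det(V_k,\dots,V_{k+n})=1$, unique up to $\mathrm{SL}(n+1,\mathbb R)$, and a matrix $M\in\mathrm{SL}(n+1,\mathbb R)$ with $V_{k+N}=MV_k$. Generalized pentagram map ($n=2s$): let $P_k$ be the hyperplane of $\mathbb{RP}^n$ through the $2s$ vertices $x_{k-2s+1},x_{k-2s+3},\dots,x_{k-1},x_{k+1},\dots,x_{k+2s-1}$. It is assumed that these vertices determine $P_k$ uniquely for every $k$ and that any $n$ consecutive $P_k$'s meet in a single point. The map is $T(x)_k=P_{k-s+1}\cap P_{k-s+2}\cap\dots\cap P_{k+s}$; afterwards it is composed with the index shift $\sigma^s$ (where $\sigma(x_k)=x_{k+1}$), i.e. redefined so that the $k$-th new vertex is the point that was previously the $(k+s)$-th, and this map is still called $T$. The new polygon is twisted with the same monodromy $M$. Induced map on invariants: if $x$ has invariants $a$ and $T(x)$ is nondegenerate, then $T(a)$ denotes the family of invariants of $T(x)$. *)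

(* Defs.v *)
From mathcomp Require Import all_boot all_order all_algebra.
From mathcomp Require Import reals exp.

Set Implicit Arguments.
Unset Strict Implicit.
Unset Printing Implicit Defensive.

Import Order.TTheory GRing.Theory Num.Theory.

Local Open Scope ring_scope.

Section Polygons.

Variables (R : realType) (n : nat).

(* A projective subspace of RP^n is represented by the corresponding linear
   subspace of R^(n+1): points have dimension 1, hyperplanes dimension n. *)
Definition polygon := int -> {vspace 'cV[R]_n.+1}.

(* The monodromy M is part of the data: the sequence x alone need not
   determine it.  For n even, PSL(n+1,R) = SL(n+1,R). *)
Definition twisted_polygon (N : nat) (M : 'M[R]_n.+1) (x : polygon) : Prop :=
  [/\ \det M = 1,
      forall k, \dim (x k) = 1%N
    & forall k, x (k + N%:Z) = (linfun (mulmx M) @: x k)%VS].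

Definition normalized_lift (N : nat) (M : 'M[R]_n.+1) (x : polygon)
    (V : int -> 'cV[R]_n.+1) : Prop :=
  [/\ forall k, x k = <[V k]>%VS,
      forall k, V (k + N%:Z) = M *m V k
    & forall k, \det (\matrix_(i < n.+1, j < n.+1) V (k + j%:Z) i 0) = 1].

(* The superscript of the invariants a_k^i runs over 1, ..., n, whereas
   ordinals start at 0: [a k i] stands for a_k^(i+1). *)
Definition invariant_family := int -> 'I_n -> R.

(* The existence of V is the nondegeneracy of the polygon. *)
Definition has_invariants (N : nat) (M : 'M[R]_n.+1) (x : polygon)
    (a : invariant_family) : Prop :=
  (forall k i, a (k + N%:Z) i = a k i) /\
  exists2 V, normalized_lift N M x V
    & forall k,
      V (k + n.+1%:Z) = (\sum_(i < n) a k i *: V (k + i.+1%:Z)) + V k.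

End Polygons.

Section Pentagram.

Variables (R : realType) (s : nat).

Implicit Types (x : polygon R s.*2) (a b : invariant_family R s.*2) (k : int).

(* The span of x_(k-2s+1), x_(k-2s+3), ..., x_(k+2s-1). *)
Definition pentagram_plane x k : {vspace 'cV[R]_((s.*2).+1)} :=
  (\sum_(j < s.*2) x (k - s.*2%:Z + 1 + j.*2%:Z)%R)%VS.

(* P_(k-s+1) :&: P_(k-s+2) :&: ... :&: P_(k+s), before the index shift. *)
Definition pentagram_unshifted x : polygon R s.*2 := fun k =>
  (\bigcap_(j < s.*2) pentagram_plane x (k - s%:Z + 1 + j%:Z)%R)%VS.

Definition pentagram x : polygon R s.*2 := fun k =>
  pentagram_unshifted x (k + s%:Z).

Definition pentagram_defined x : Prop :=
  (forall k, \dim (pentagram_plane x k) = s.*2) /\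
  (forall k, \dim (\bigcap_(j < s.*2) pentagram_plane x (k + j%:Z)%R)%VS = 1%N).

(* The graph of the partial map a |-> T(a) induced on the invariants: T(a) is
   defined and equal to b.  The image polygon keeps the monodromy M. *)
Definition pentagram_on_invariants (N : nat) a b : Prop :=
  exists (M : 'M[R]_((s.*2).+1)) x,
    [/\ twisted_polygon N M x, has_invariants N M x a,
        pentagram_defined x & has_invariants N M (pentagram x) b].

(* The exponent for the superscript m: -1 + l/s if m = 2l+1, and l/s if
   m = 2l. *)
Definition scaling_exponent (m : nat) : R :=
  if odd m then -1 + (m./2)%:R / s%:R else (m./2)%:R / s%:R.

Definition scaling (t : R) a : invariant_family R s.*2 := fun k i =>
  t `^ scaling_exponent i.+1 * a k i.

End Pentagram.

(* Main.v *)
Require Import Defs.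
From mathcomp Require Import all_boot all_order all_algebra.
From mathcomp Require Import reals exp.
From mathcomp Require Import zify ring.

Set Implicit Arguments.
Unset Strict Implicit.
Unset Printing Implicit Defensive.

Import Order.TTheory GRing.Theory Num.Theory.

Local Open Scope ring_scope.

(* Write n = 2s and a_k^0 = 1. The recursion says that the sum E_k of the
   a_k^m V_(k+m) over even m equals V_(k+n+1) minus the sum of the
   a_k^m V_(k+m) over odd m. The first expression lies in P_(k+j) for j odd,
   the second one for j even (1 <= j <= n), so E_k spans T(x)_k. Put
   c = t^(1/n) and mu = c^(n+1); if V' is a lift with invariants S_t(a), then
   U_k = c^k V'_k satisfies the recursion of V with all even coefficients
   (m = 0 included) multiplied by mu. The recursion of E comes from a common
   left multiple of the even and odd difference operators, so it is transformed
   in the same way. Normalising E to determinant 1 multiplies it by a scalar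
   sequence; the ratio of the sequences for S_t(a) and a is c^(-k) times a
   sequence with periods N and n+1, which are coprime. Hence the ratio is a
   constant times c^(-k), and the weights of S_t come out. *)

(** * Interleaved sums and periodic sequences *)

Lemma sum_even_odd (V : nmodType) (F : nat -> V) r :
  \sum_(m < r.*2) F m = \sum_(l < r) F l.*2 + \sum_(l < r) F (l.*2).+1.
Proof.
elim: r => [|r IHr]; first by rewrite !big_ord0 addr0.
by rewrite doubleS 4!big_ord_recr IHr /= -!addrA; congr (_ + _); rewrite addrCA.
Qed.

Lemma periodic_mulz (T : Type) (f : int -> T) (p : int) :
  (forall k, f (k + p) = f k) -> forall z k, f (k + z * p) = f k.
Proof.
move=> fp; elim/int_ind => [|n IHn|n IHn] k; first by rewrite mul0r addr0.
  by rewrite intS mulrDl mul1r addrA IHn fp.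
by rewrite -[LHS]fp -[RHS]IHn; congr f; lia.
Qed.

(** By Bezout, every integer is a multiple of [p] plus a multiple of [q], hence is reached from 0 by
    the two periods. *)
Lemma coprime_periodic_const (T : Type) (f : int -> T) (p q : nat) :
  coprime p q -> (forall k, f (k + p%:Z) = f k) ->
  (forall k, f (k + q%:Z) = f k) -> forall k, f k = f 0.
Proof.
move=> cpq fp fq k.
have /coprimezP[[u v] /= uv] : coprimez p q by rewrite /coprimez /gcdz /=.
have -> : k = 0 + k * u * p%:Z + k * v * q%:Z.
  by rewrite add0r -!mulrA -mulrDr uv mulr1.
by rewrite (periodic_mulz fq) (periodic_mulz fp).
Qed.

(** * Matrices given by their columns *)

Section Columns.

Variable R : fieldType.

Definition cols p q (u : 'I_q -> 'cV[R]_p) : 'M[R]_(p, q) :=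
  \matrix_(i, j) u j i 0.

Lemma cols_mulE p q (u : 'I_q -> 'cV[R]_p) (v : 'cV[R]_q) :
  cols u *m v = \sum_j v j 0 *: u j.
Proof.
apply/matrixP => i z; rewrite !ord1 !mxE summxE; apply: eq_bigr => j _.
by rewrite !mxE mulrC.
Qed.

Lemma cols_inj p (u : 'I_p -> 'cV[R]_p) (f g : 'I_p -> R) :
  cols u \in unitmx -> \sum_j f j *: u j = \sum_j g j *: u j -> f =1 g.
Proof.
move=> Uu fg j.
have E (h : 'I_p -> R) : \sum_j h j *: u j = cols u *m \col_j h j.
  by rewrite cols_mulE; apply: eq_bigr => i _; rewrite mxE.
rewrite !E in fg; have /matrixP/(_ j 0) := can_inj (mulKmx Uu) fg.
by rewrite !mxE.
Qed.

Lemma cols_scale_unitmx p (u : 'I_p -> 'cV[R]_p) (f : 'I_p -> R) :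
  cols (fun j => f j *: u j) \in unitmx -> cols u \in unitmx.
Proof.
have -> : cols (fun j => f j *: u j) = cols u *m diag_mx (\row_j f j).
  by apply/matrixP => i j; rewrite mul_mx_diag !mxE mulrC.
by rewrite unitmx_mul => /andP[].
Qed.

Lemma unitmx_cols_scale p (u : 'I_p -> 'cV[R]_p) (f : 'I_p -> R) :
  (forall j, f j != 0) ->
  cols u \in unitmx -> cols (fun j => f j *: u j) \in unitmx.
Proof.
move=> f0 Uu; apply: (@cols_scale_unitmx _ _ (fun j => (f j)^-1)).
rewrite (_ : cols _ = cols u) //.
by apply/matrixP => i j; rewrite !mxE mulKf.
Qed.

End Columns.

(** * Even and odd difference operators and their common multiples *)

Section DifferenceOperators.

Variable R : fieldType.

(* The polynomial [p] stands for the difference operator \sum_j p_j tau^(2j),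
   tau being the index shift. *)
Definition apply_op (V : lmodType R) (U : int -> V) (k : int) (p : {poly R}) :=
  \sum_(j < size p) p`_j *: U (k + j.*2%:Z).

Lemma apply_op_wide (V : lmodType R) (U : int -> V) (k : int) B
    (p : {poly R}) : (size p <= B)%N ->
  apply_op U k p = \sum_(j < B) p`_j *: U (k + j.*2%:Z).
Proof.
move=> pB; rewrite /apply_op.
rewrite (big_ord_widen B (fun j => p`_j *: U (k + j.*2%:Z))) // big_mkcond.
apply: eq_bigr => j _ /=.
by case: ltnP => // pj; rewrite nth_default // scale0r.
Qed.

Lemma apply_op_sum (V : lmodType R) (U : int -> V) (k : int) q
    (b : 'I_q -> R) (g : 'I_q -> {poly R}) :
  apply_op U k (\sum_m b m *: g m) = \sum_m b m *: apply_op U k (g m).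
Proof.
pose B := \max_m size (g m).
have gB m : (size (g m) <= B)%N by exact: leq_bigmax.
rewrite (@apply_op_wide _ _ _ B); last first.
  apply: (leq_trans (size_sum _ _ _)); apply/bigmax_leqP => m _.
  exact: leq_trans (size_scale_leq _ _) (gB m).
under [RHS]eq_bigr do rewrite (apply_op_wide _ _ (gB _)) scaler_sumr.
rewrite exchange_big; apply: eq_bigr => j _ /=.
rewrite coef_sum scaler_suml; apply: eq_bigr => m _.
by rewrite coefZ scalerA.
Qed.

Lemma apply_opXnM (V : lmodType R) (U : int -> V) (k : int) l (p : {poly R}) :
  apply_op U k ('X^l * p) = apply_op U (k + l.*2%:Z) p.
Proof.
rewrite (@apply_op_wide _ _ _ (l + size p)); last first.
  by apply: leq_trans (size_polyMleq _ _) _; rewrite size_polyXn.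
rewrite big_split_ord /= big1 ?add0r => [|j _]; last first.
  by rewrite coefXnM ltn_ord scale0r.
apply: eq_bigr => j _; rewrite coefXnM ltnNge leq_addr /= addKn.
by congr (_ *: U _); lia.
Qed.

Variable s : nat.

Lemma apply_op_interleaved (V : lmodType R) (U : int -> V) (k : int)
    (p : {poly R}) : (size p <= s.+1)%N ->
  apply_op U k p
  = \sum_(m < (s.*2).+1) (if odd m then 0 else p`_(m./2)) *: U (k + m%:Z).
Proof.
move=> ps; rewrite (apply_op_wide _ _ ps).
pose F m := (if odd m then 0 else p`_(m./2)) *: U (k + m%:Z).
transitivity (\sum_(m < s.+1.*2) F m).
  rewrite sum_even_odd [X in _ + X]big1 ?addr0 => [|l _]; last first.
    by rewrite /F /= odd_double scale0r.
  by apply: eq_bigr => l _; rewrite /F odd_double doubleK.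
by rewrite doubleS big_ord_recr /= {2}/F /= odd_double scale0r addr0.
Qed.

(* [e k] and [o k] are the even and odd parts of the operator annihilating a
   polygon. The common left multiples [O * e = E * o], with [O] odd and [E]
   even, give the operator [O - E] annihilating the image polygon; replacing
   [e] by [mu e] replaces [E] by [mu E]. Finding [O] and [E] means solving n + 1
   linear equations in n + 1 unknowns; this system is regular because n + 1
   consecutive points of the image polygon are independent. *)
Definition product_op (e o : int -> {poly R}) (k : int) (m : nat) : {poly R} :=
  'X^(m./2) * (if odd m then e else o) (k + m%:Z).

Lemma size_product_op (e o : int -> {poly R}) (k : int) (m : nat) :
  (forall k, size (e k) <= s.+1)%N ->
  (forall k, size (o k) <= s.+1)%N -> (m <= (s.*2).+1)%N ->
  (size (product_op e o k m) <= (s.*2).+1)%N.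
Proof.
move=> se so ms; rewrite /product_op.
apply: leq_trans (size_polyMleq _ _) _; rewrite size_polyXn /=.
have : (size ((if odd m then e else o) (k + m%:Z)%R) <= s.+1)%N.
  by case: (odd m).
by move: (size _) => z; lia.
Qed.

(** For [m] odd the power of ['X] moves the base point from [k + 1] to [k + m]. For [m] even it
    moves it to [k + m + 1], where the hypothesis turns [o] into [mu] times [e]. *)
Lemma apply_product_op (e o : int -> {poly R}) (V : lmodType R) (U : int -> V)
    (mu : R) (k : int) (m : nat) :
  (forall k, apply_op U (k + 1) (o k) = mu *: apply_op U k (e k)) ->
  apply_op U (k + 1) (product_op e o k m)
  = (if odd m then 1 else mu) *: apply_op U (k + m%:Z) (e (k + m%:Z)).
Proof.
move=> hU; rewrite /product_op apply_opXnM.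
case: ifP => om; last rewrite -hU; rewrite ?scale1r; congr (apply_op U _ _).
all: lia.
Qed.

(** The linear relation is solved among the polynomials [product_op e o k m], which involve neither
    [U'] nor [mu]; hence one [b] serves all of them. *)
Lemma image_recurrence (e o : int -> {poly R})
    (U : int -> 'cV[R]_((s.*2).+1)) (k : int) :
  (forall k, size (e k) <= s.+1)%N -> (forall k, size (o k) <= s.+1)%N ->
  (forall k, apply_op U (k + 1) (o k) = apply_op U k (e k)) ->
  cols (fun j : 'I_(s.*2).+1 => apply_op U (k + j%:Z) (e (k + j%:Z)))
    \in unitmx ->
  exists b : 'I_(s.*2).+1 -> R,
    forall (V : lmodType R) (U' : int -> V) mu,
    (forall k, apply_op U' (k + 1) (o k) = mu *: apply_op U' k (e k)) ->
    apply_op U' (k + (s.*2).+1%:Z) (e (k + (s.*2).+1%:Z))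
    = \sum_m (b m * (if odd m then 1 else mu))
        *: apply_op U' (k + m%:Z) (e (k + m%:Z)).
Proof.
move=> se so hU; set n := s.*2; set g := product_op e o k.
have sg m : (m <= n.+1)%N -> (size (g m) <= n.+1)%N by exact: size_product_op.
pose A : 'M[R]_n.+1 := \matrix_(j, m) (g m)`_j.
(* Evaluation at [U] factors the invertible matrix of image vectors through [A], so [A] is
   invertible. *)
have -> : cols (fun j : 'I_n.+1 => apply_op U (k + j%:Z) (e (k + j%:Z)))
    = cols (fun j : 'I_n.+1 => U (k + 1 + j.*2%:Z)) *m A.
  apply/matrixP => i m; rewrite !mxE.
  have := @apply_product_op e o _ U 1 k m; rewrite if_same scale1r => <-.
    rewrite (apply_op_wide _ _ (sg _ (ltnW (ltn_ord m)))) summxE.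
    by apply: eq_bigr => j _; rewrite !mxE mulrC.
  by move=> k'; rewrite hU scale1r.
rewrite unitmx_mul => /andP[_ UA].
pose v : 'cV[R]_n.+1 := invmx A *m \col_j (g n.+1)`_j.
have gE : g n.+1 = \sum_(m < n.+1) v m 0 *: g m.
  apply/polyP => j; rewrite coef_sum; case: (ltnP j n.+1) => jn; last first.
    rewrite nth_default ?(leq_trans (sg _ _) jn) // big1 // => m _.
    by rewrite coefZ nth_default ?mulr0 // (leq_trans (sg _ _) jn) // ltnW.
  have /matrixP/(_ (Ordinal jn) 0) : A *m v = \col_j (g n.+1)`_j.
    by rewrite mulKVmx.
  rewrite !mxE /= => <-; apply: eq_bigr => m _; rewrite coefZ mulrC.
  by rewrite !mxE.
exists (fun m => v m 0) => V U' mu hU'.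
have /(congr1 (apply_op U' (k + 1))) := gE.
rewrite apply_op_sum (apply_product_op _ _ hU') /= odd_double scale1r => ->.
by apply: eq_bigr => m _; rewrite (apply_product_op _ _ hU') scalerA.
Qed.

End DifferenceOperators.

(** * Lifts of a polygon and of its pentagram image *)

Section PentagramLift.

Variables (R : realType) (s : nat).

Local Notation n := s.*2.

Implicit Types (a b : invariant_family R n) (k : int) (c : R) (m : nat).

(* With a_k^0 = 1 and the value -1 at m = n + 1, the recursion reads
   \sum_(m <= n + 1) coefficient a k m *: V (k + m) = 0. *)
Definition coefficient a k m : R :=
  if m is i.+1 then oapp (a k) (-1) (insub i) else 1.

Definition even_part a k : {poly R} := \poly_(l < s.+1) coefficient a k l.*2.

(** The sign carries the odd terms across the recursion; index [l] means offset 2l + 1 from [k], as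
    the operator is applied at [k + 1]. *)
Definition odd_part a k : {poly R} :=
  - \poly_(l < s.+1) coefficient a k (l.*2).+1.

(* For c = t^(1/n) this is the factor of the scaling S_t. *)
Definition weight c m : R := c ^+ m / (if odd m then c ^+ n.+1 else 1).

Lemma size_even_part a k : (size (even_part a k) <= s.+1)%N.
Proof. exact: size_poly. Qed.

Lemma size_odd_part a k : (size (odd_part a k) <= s.+1)%N.
Proof. by rewrite size_polyN size_poly. Qed.

Lemma coefficientS a k (i : 'I_n) : coefficient a k i.+1 = a k i.
Proof. by rewrite /coefficient valK. Qed.

Lemma coefficient_last a k : coefficient a k n.+1 = -1.
Proof. by rewrite /coefficient insubF // ltnn. Qed.

(** The two constant end coefficients are preserved: the weight is 1 at 0 and also at n + 1, which
    is odd. *)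
Lemma coefficient_weight c a a' k m : c != 0 ->
  (forall k i, a' k i = weight c i.+1 * a k i) -> (m <= n.+1)%N ->
  coefficient a' k m = weight c m * coefficient a k m.
Proof.
move=> c0 ha'; case: m => [|i]; first by rewrite /weight expr0 divr1 mul1r.
rewrite ltnS leq_eqVlt => /predU1P[-> | iltn].
  by rewrite !coefficient_last /weight /= odd_double divff ?mul1r ?expf_neq0.
by rewrite -[i]/(val (Ordinal iltn)) !coefficientS ha'.
Qed.

Lemma recurrence_coefficient a k (V : lmodType R) (U : int -> V) :
  U (k + n.+1%:Z) = \sum_(i < n) a k i *: U (k + i.+1%:Z) + U k ->
  \sum_(m < s.+1.*2) coefficient a k m *: U (k + m%:Z) = 0.
Proof.
move=> hU; rewrite doubleS big_ord_recr big_ord_recl /=.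
rewrite [X in _ + X *: _](coefficient_last a k) scaleN1r hU addr0 scale1r.
apply/eqP; rewrite subr_eq0 addrC; apply/eqP; congr (_ + _).
by apply: eq_bigr => i _; rewrite -coefficientS.
Qed.

Lemma lift_recurrence c a a' (V : lmodType R) (U : int -> V) : c != 0 ->
  (forall k i, a' k i = weight c i.+1 * a k i) ->
  (forall k, U (k + n.+1%:Z) = \sum_(i < n) a' k i *: U (k + i.+1%:Z) + U k) ->
  forall k, apply_op (fun j => c ^ j *: U j) (k + 1) (odd_part a k)
    = c ^+ n.+1 *: apply_op (fun j => c ^ j *: U j) k (even_part a k).
Proof.
move=> c0 ha' hU k; set U' := fun j => _.
have /(congr1 ( *:%R (c ^ (k + n.+1%:Z)))) := recurrence_coefficient (hU k).
rewrite scaler0 scaler_sumr.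
under eq_bigr => m _.
  rewrite (coefficient_weight k c0 ha' (ltn_ord m)).
  (* The factor c^(k+n+1) times the weight of [m] is c^(k+m) for [m] odd and c^(n+1) c^(k+m) for [m]
     even. *)
  rewrite (_ : _ *: _ = (if odd m then 1 else c ^+ n.+1)
      *: (coefficient a k m *: U' (k + m%:Z))); last first.
    rewrite /U' !scalerA !expfzDr // /weight -!exprnP; congr (_ *: _).
    have ? : c ^+ n.+1 != 0 by rewrite expf_neq0.
    by case: ifP => _; field.
  over.
rewrite (sum_even_odd (fun m => (if odd m then 1 else c ^+ n.+1)
      *: (coefficient a k m *: U' (k + m%:Z)))) addrC => /eqP.
rewrite addr_eq0 => /eqP E.
rewrite (apply_op_wide _ _ (size_odd_part a k)).
rewrite (apply_op_wide _ _ (size_even_part a k)) scaler_sumr.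
transitivity (- \sum_(l < s.+1) (if odd (l.*2).+1 then 1 else c ^+ n.+1)
    *: (coefficient a k (l.*2).+1 *: U' (k + (l.*2).+1%:Z))).
  rewrite -sumrN; apply: eq_bigr => l _.
  rewrite /= odd_double scale1r coefN coef_poly ltn_ord scaleNr.
  by congr (- (_ *: U' _)); lia.
rewrite E opprK; apply: eq_bigr => l _.
by rewrite odd_double coef_poly ltn_ord.
Qed.

Lemma even_part_mem_pentagram (x : polygon R n) (U : int -> 'cV[R]_n.+1) a mu :
  mu != 0 -> (forall k, x k = <[U k]>%VS) ->
  (forall k, apply_op U (k + 1) (odd_part a k)
    = mu *: apply_op U k (even_part a k)) ->
  forall k, apply_op U k (even_part a k) \in pentagram x k.
Proof.
move=> mu0 xU hU k; rewrite /pentagram /pentagram_unshifted memvE.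
apply/subv_bigcapP => j _; rewrite -memvE /pentagram_plane.
have Psum (q : int) (p : {poly R}) : (size p <= s.+1)%N ->
    (forall l : 'I_s.+1, exists i : 'I_n, q + l.*2%:Z
      = k + s%:Z - s%:Z + 1 + j%:Z - n%:Z + 1 + i.*2%:Z) ->
    apply_op U q p \in (\sum_(i < n)
      x (k + s%:Z - s%:Z + 1 + j%:Z - n%:Z + 1 + i.*2%:Z)%R)%VS.
  move=> sp hq; rewrite (apply_op_wide _ _ sp); apply: memv_suml => l _.
  apply: memvZ; have [i ->] := hq l.
  by apply: (subvP (sumv_sup i _ (subvv _))); rewrite // xU memv_line.
have js : (j./2 < s)%N by have := ltn_ord j; lia.
(* The position of the [l]-th vertex of the operator among those spanning the plane; halving [j]
   gives one formula for both parities. *)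
have iP (l : 'I_s.+1) : (l + (s.-1 - j./2) < n)%N by have := ltn_ord l; lia.
case: (boolP (odd j)) => oj.
  suff : mu *: apply_op U k (even_part a k) \in (\sum_(i < n)
      x (k + s%:Z - s%:Z + 1 + j%:Z - n%:Z + 1 + i.*2%:Z)%R)%VS.
    by move/(memvZ mu^-1); rewrite scalerA mulVf // scale1r.
  rewrite -hU; apply: Psum => [|l]; first exact: size_odd_part.
  by exists (Ordinal (iP l)) => /=; lia.
apply: Psum => [|l]; first exact: size_even_part.
by exists (Ordinal (iP l)) => /=; lia.
Qed.

(** Stated for a general [c] so as to cover [a] itself (c = 1) and its scaling, with [E] built from
    the same operators in both cases. *)
Lemma image_lift N c a a' b : c != 0 ->
  (forall k i, a' k i = weight c i.+1 * a k i) ->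
  (forall k i, a (k + N%:Z) i = a k i) ->
  pentagram_on_invariants N a' b ->
  exists (U : int -> 'cV[R]_n.+1) (lam : int -> R),
    let E k := apply_op U k (even_part a k) in
    [/\ forall k, apply_op U (k + 1) (odd_part a k) = c ^+ n.+1 *: E k,
        forall k, lam k != 0,
        forall k, cols (fun j : 'I_n.+1 => E (k + j%:Z)) \in unitmx,
        forall k, lam (k + N%:Z) * c ^+ N = lam k
      & forall k, lam (k + n.+1%:Z) *: E (k + n.+1%:Z)
          = \sum_(m < n.+1) (coefficient b k m * lam (k + m%:Z))
              *: E (k + m%:Z)].
Proof.
move=> c0 ha' aN [M [x [_ [_ [V [xV VN Vdet] Vrec]] _]]].
case=> _ [W [xW WN Wdet] Wrec].
pose U k := c ^ k *: V k; pose E k := apply_op U k (even_part a k).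
have hU := lift_recurrence c0 ha' Vrec.
have xU k : x k = <[U k]>%VS.
  rewrite xV; apply/eqP; rewrite eqEsubv -!memvE memvZ ?memv_line // andbT.
  by apply/vlineP; exists (c ^ - k); rewrite scalerA -expfzDr // addNr scale1r.
(* The boolean equality lets [xchoose] pick the scalar as a function of [k]. *)
have EW k : exists nu, E k == nu *: W k.
  have mu0 : c ^+ n.+1 != 0 by rewrite expf_neq0.
  have : E k \in pentagram x k := even_part_mem_pentagram mu0 xU hU k.
  by rewrite xW => /vlineP[nu ->]; exists nu.
(* The vertices are independent and the coefficient of [U k] in [E k] is 1. *)
have E0 k : E k != 0.
  have UU : cols (fun j : 'I_n.+1 => U (k + j%:Z)) \in unitmx.
    apply: (@unitmx_cols_scale _ _ _ (fun j : 'I_n.+1 => c ^ (k + j%:Z))).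
      by move=> j; rewrite expfz_neq0.
    by rewrite unitmxE [\det _]Vdet unitr1.
  apply/eqP; rewrite /E (apply_op_interleaved _ _ (size_even_part a k)) => Ek.
  have Z : \sum_(j < n.+1) 0 *: U (k + j%:Z) = 0.
    by rewrite big1 // => m _; rewrite scale0r.
  have := cols_inj UU (etrans Ek (esym Z)) ord0.
  by rewrite /= coef_poly /= => /eqP; rewrite oner_eq0.
have nu0 k : xchoose (EW k) != 0.
  have /eqP Ek := xchooseP (EW k).
  by apply: contraNneq (E0 k) => nu0; rewrite Ek nu0 scale0r.
pose lam k := (xchoose (EW k))^-1.
have WE k : W k = lam k *: E k.
  have /eqP Ek := xchooseP (EW k).
  by rewrite [E k]Ek scalerA mulVf // scale1r.
have Wunit k : cols (fun j : 'I_n.+1 => W (k + j%:Z)) \in unitmx.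
  by rewrite unitmxE [\det _]Wdet unitr1.
have lam0 k : lam k != 0 by rewrite invr_eq0.
have EN k : E (k + N%:Z) = c ^+ N *: (M *m E k).
  rewrite /E; have -> : even_part a (k + N%:Z) = even_part a k.
    apply/polyP => l; rewrite !coef_poly; case: ifP => // _.
    case: l.*2 => //= m; case: insub => //= i; exact: aN.
  rewrite /apply_op mulmx_sumr scaler_sumr; apply: eq_bigr => l _.
  rewrite /U addrAC VN -!scalemxAr !scalerA [c ^ (_ + N%:Z)]expfzDr // -exprnP.
  by congr (_ *: _); ring.
exists U, lam; split=> // k.
- have := Wunit k; rewrite (_ : cols _ = cols (fun j : 'I_n.+1 =>
    lam (k + j%:Z) *: E (k + j%:Z))); first exact: cols_scale_unitmx.
  by apply/matrixP => i j; rewrite !mxE WE mxE.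
- have := WN k; rewrite !WE EN -scalemxAr scalerA => /eqP.
  rewrite -subr_eq0 -scalerBl scaler_eq0 subr_eq0 => /orP[/eqP//|/eqP MEk].
  by have := E0 (k + N%:Z); rewrite EN MEk scaler0 eqxx.
- rewrite -/(E _) -WE Wrec big_ord_recl addrC; congr (_ + _).
    by rewrite mul1r addr0 WE.
  by apply: eq_bigr => i _; rewrite -coefficientS -scalerA -WE.
Qed.

End PentagramLift.

(** * Comparison of the images of [a] and of its scaling *)

Lemma scaling_weight (R : realType) (s : nat) (t : R) m : (0 < s)%N -> 0 < t ->
  t `^ scaling_exponent R s m = weight s (t `^ (s.*2)%:R^-1) m.
Proof.
move=> s0 t0; rewrite /weight -!powR_mulrn ?powR_ge0 // -!powRrM.
have sR : (s%:R : R) != 0 by rewrite pnatr_eq0 -lt0n.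
have hm : (m%:R : R) = (odd m)%:R + 2 * (m./2)%:R.
  by rewrite -{1}[m]odd_double_half natrD -mul2n natrM.
(* For m = 2l + 1 the exponent is (m - (n + 1)) / n = -1 + l/s; for m = 2l it is m/n = l/s. *)
rewrite /scaling_exponent; case: ifP => om; rewrite om in hm.
  rewrite -powRN -powRD; last by rewrite (gt_eqF t0) implybT.
  by congr (_ `^ _); rewrite hm -[(s.*2.+1)%:R]natr1 -mul2n natrM mulr1n; field.
by rewrite divr1; congr (_ `^ _); rewrite hm mulr0n add0r -mul2n natrM; field.
Qed.

Theorem mainTheorem2 (R : realType) (s N : nat) (hs : (1 <= s)%N)
    (hN : (0 < N)%N) (hcop : coprime N (s.*2).+1) (t : R) (ht : 0 < t)
    (a Ta TSa : invariant_family R s.*2)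
    (hTa : pentagram_on_invariants N a Ta)
    (hTSa : pentagram_on_invariants N (scaling t a) TSa) :
  forall (k : int) (i : 'I_(s.*2)), TSa k i = scaling t Ta k i.
Proof.
have aN : forall k i, a (k + N%:Z) i = a k i.
  by case: hTa => M [x [_ [aN _] _ _]].
set c := t `^ (s.*2)%:R^-1.
have c0 : c != 0 by rewrite gt_eqF // powR_gt0.
have a1 k i : a k i = weight s 1 i.+1 * a k i.
  by rewrite /weight !expr1n if_same divr1 mul1r.
have ac k i : scaling t a k i = weight s c i.+1 * a k i.
  by rewrite /scaling scaling_weight.
have [U [lam []]] := image_lift (oner_neq0 R) a1 aN hTa.
have [U' [lam' []]] := image_lift c0 ac aN hTSa.
set E := fun k => apply_op U k (even_part a k).
set E' := fun k => apply_op U' k (even_part a k).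
move=> hU' lam'0 unitE' lam'N recE' hU lam0 unitE lamN recE.
set mu := c ^+ (s.*2).+1 in hU'.
have mu0 : mu != 0 by rewrite expf_neq0.
have hU1 k : apply_op U (k + 1) (odd_part a k) = E k.
  by rewrite hU expr1n scale1r.
(* Both recursions determine the same [b m]; eliminating it gives this cross-multiplied identity. *)
have key k m : (m < (s.*2).+1)%N ->
    coefficient TSa k m * lam' (k + m%:Z) * lam (k + (s.*2).+1%:Z)
    = coefficient Ta k m * lam (k + m%:Z) * lam' (k + (s.*2).+1%:Z)
      * (if odd m then 1 else mu).
  move=> ms; have [b bE] := image_recurrence (size_even_part a)
    (size_odd_part a) hU1 (unitE k).
  have := recE k; rewrite /E (bE _ _ _ hU) expr1n scaler_sumr.
  under eq_bigr do rewrite if_same mulr1 scalerA.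
  move/(cols_inj (unitE k))/(_ (Ordinal ms)) => /= <-.
  have := recE' k; rewrite /E' (bE _ _ _ hU') scaler_sumr.
  under eq_bigr do rewrite scalerA.
  move/(cols_inj (unitE' k))/(_ (Ordinal ms)) => /= <-.
  by move: (if odd m then 1 else mu) (lam _) (lam' _) (b _) => w x x' y; ring.
(* The case m = 0, where both coefficients are 1. *)
have step k : lam' k * lam (k + (s.*2).+1%:Z)
    = lam k * lam' (k + (s.*2).+1%:Z) * mu.
  by have := key k 0%N isT; rewrite /= !mul1r addr0.
pose sigma k := c ^ k * (lam' k / lam k).
have sigmaN k : sigma (k + N%:Z) = sigma k.
  rewrite /sigma -(lam'N k) -(lamN k) expr1n mulr1 expfzDr // -exprnP.
  by field; rewrite lam0.
have sigmaS k : sigma (k + (s.*2).+1%:Z) = sigma k.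
  have := step k; rewrite /sigma expfzDr // -exprnP -/mu.
  have lamn0 := lam0 (k + (s.*2).+1%:Z).
  move=> /(canRL (mulfK lamn0)) ->.
  by field; rewrite lamn0 lam0.
move=> k i.
have sigma0 := coprime_periodic_const hcop sigmaN sigmaS.
have lamE j : lam' j = sigma 0 * lam j / c ^ j.
  rewrite -(sigma0 j) /sigma; field.
  by rewrite lam0 expfz_neq0.
rewrite /scaling scaling_weight // -/c.
have sg0 : sigma 0 != 0.
  by apply: contraNneq (lam'0 0) => sg0; rewrite lamE sg0 !mul0r.
have := key k i.+1 (ltn_ord i).
rewrite !coefficientS !lamE !expfzDr // -!exprnP -/mu => keyE.
have ck0 : c ^ k != 0 by rewrite expfz_neq0.
have cm0 : c ^+ i.+1 != 0 by rewrite expf_neq0.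
move: (sigma 0) sg0 keyE => S S0 keyE.
move: (lam0 (k + i.+1%:Z)) (lam0 (k + (s.*2).+1%:Z)) => lm0 ln0.
(* The factor of [TSa k i] in [keyE], to be cancelled. *)
have d0 : S * lam (k + i.+1%:Z) / (c ^ k * c ^+ i.+1)
    * lam (k + (s.*2).+1%:Z) != 0.
  by rewrite !(mulf_eq0, invr_eq0, negb_or) S0 lm0 ck0 cm0 ln0.
apply: (mulIf d0); rewrite mulrA keyE /weight -/mu.
move: (c ^+ i.+1) cm0 (mu) mu0 (c ^ k) ck0 => w w0 v v0 u u0.
by case: ifP => _; field; rewrite ?w0 ?v0 u0.
Qed.
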